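(* Let $U\subset\mathbb{R}^N$ be a neighborhood of the origin and let the map $\Phi=(\Phi_1,\dots,\Phi_N):U\to\mathbb{R}^N$ be such that $\Phi_k\in C^{\sigma_k}(U)$ for $k=1,\dots,N$. The following conditions are equivalent: 1. There are constants $C>0$ and $\varepsilon_0>0$ such that $\Phi(\mathrm{Box}(\varepsilon))\subset\mathrm{Box}(C\varepsilon)$ for all $0<\varepsilon\le\varepsilon_0$. 2. For the coordinate functions of $\Phi$ it holds $\Phi_k(x)=O(\varepsilon^{\sigma_k})$ as $\varepsilon\to0$ and $x\in\mathrm{Box}(\varepsilon)$, $k=1,\dots,N$. 3. For every $k$, $D^\alpha\Phi_k(0)=0$ for all multiindices $\alpha$ such that $\sigma(\alpha)<\sigma_k$. 4. There are limits, uniform in a neighborhood of the origin, $$L(x)=\lim_{\varepsilon\to0}\delta_\varepsilon^{-1}\circ\Phi\circ\delta_\varepsilon(x),\qquad DL(x)=\lim_{\varepsilon\to0}D\delta_\varepsilon^{-1}\circ D\Phi\circ D\delta_\varepsilon(x).$$ Under these conditions the coordinate functions of the map $L$ are polynomials.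
   Context: Fix a tuple $(\sigma_1,\dots,\sigma_N)$ of positive integers. For $\varepsilon>0$ set $\delta_\varepsilon(x_1,\dots,x_N)=(\varepsilon^{\sigma_1}x_1,\dots,\varepsilon^{\sigma_N}x_N)$. Set $\|x\|=\max_{k}|x_k|^{1/\sigma_k}$ and $\mathrm{Box}(r)=\{x\in\mathbb{R}^N:\|x\|<r\}$. For a multiindex $\alpha=(\alpha_1,\dots,\alpha_N)$ of nonnegative integers, $D^\alpha$ is the usual partial derivative of order $|\alpha|=\alpha_1+\dots+\alpha_N$, and the weight of $\alpha$ is $\sigma(\alpha)=\sigma_1\alpha_1+\dots+\sigma_N\alpha_N$. The expression $D\delta_\varepsilon^{-1}\circ D\Phi\circ D\delta_\varepsilon(x)$ is the differential at $x$ of $\delta_\varepsilon^{-1}\circ\Phi\circ\delta_\varepsilon$, i.e. the matrix with entries $\varepsilon^{\sigma_l-\sigma_k}\frac{\partial\Phi_k}{\partial x_l}(\delta_\varepsilon x)$. *)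

(* Defs.v *)
(* MathComp-Analysis; [R : realType] plays the role of the real line. *)
From HB Require Import structures.
From mathcomp Require Import all_boot all_order all_algebra.
From mathcomp Require Import all_classical all_reals all_analysis.
(* The notations of mpoly clash with those of MathComp-Analysis. *)
From mathcomp Require Import -(notations) mpoly.

Set Implicit Arguments.
Unset Strict Implicit.
Unset Printing Implicit Defensive.

Import Order.TTheory GRing.Theory Num.Theory.
Import numFieldNormedType.Exports.

Local Open Scope classical_set_scope.
Local Open Scope ring_scope.

Section Dilations.
Variables (R : realType) (N : nat) (sigma : 'I_N -> nat).
Implicit Types (eps r : R) (x : 'rV[R]_N).

Definition dil eps x : 'rV[R]_N := \row_k (eps ^+ sigma k * x 0 k).

Lemma dilK eps : eps != 0 -> cancel (dil eps) (dil eps^-1).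
Proof.
move=> eps0 x; apply/rowP => k.
by rewrite !mxE mulrA exprVn mulVf ?mul1r// expf_neq0.
Qed.

(* [powR] satisfies [0 `^ a = 0] for [a != 0], hence [hnorm 0 = 0] when the
   weights are positive. *)
Definition hnorm x : R :=
  \big[Num.max/0]_(k < N) (`|x 0 k| `^ (sigma k)%:R^-1).

Definition Box r : set 'rV[R]_N := [set x | hnorm x < r].

(* A multiindex is an element of [multinom N]; its length is [mdeg]. *)
Definition weight (alpha : multinom N) : nat :=
  (\sum_(k < N) sigma k * alpha k)%N.

End Dilations.

Section PartialDerivatives.
Variables (R : realType) (N : nat).
Implicit Types (f : 'rV[R]_N -> R) (i : 'I_N).

Definition pder i f : 'rV[R]_N -> R := 'D_(delta_mx 0 i) f.

(* The derivatives are taken in the fixed order d_0^(alpha 0) (d_1^(alpha 1)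
   ( ... f)); this choice is immaterial when f is of class C^|alpha|. *)
Definition Dmulti (alpha : multinom N) f : 'rV[R]_N -> R :=
  foldr (fun i g => iter (alpha i) (pder i) g) f (enum 'I_N).

(* For open U: all iterated partial derivatives of f of order at most m exist
   and are continuous on U. Only the values of f on U matter. *)
Fixpoint Ck (m : nat) (U : set 'rV[R]_N) f : Prop :=
  (forall x, U x -> {for x, continuous f}) /\
  if m is m'.+1 then
    forall i, (forall x, U x -> derivable f x (delta_mx 0 i)) /\
              Ck m' U (pder i f)
  else True.

End PartialDerivatives.

Section Rescaling.
Variables (R : realType) (N : nat) (sigma : 'I_N -> nat).
Variable Phi : 'rV[R]_N -> 'rV[R]_N.

(* For eps > 0, [dil sigma eps^-1] is the inverse of [dil sigma eps] ([dilK]). *)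
Definition rescale (eps : R) : 'rV[R]_N -> 'rV[R]_N :=
  dil sigma eps^-1 \o Phi \o dil sigma eps.

(* [jacobian] acts on row vectors from the right: its (l, k) entry is the l-th
   partial derivative of the k-th coordinate function, so both matrices below
   are transposes of the usual ones. *)
Definition rescaling_limit (V : set 'rV[R]_N) (L : 'rV[R]_N -> 'rV[R]_N) :=
  [/\ open_nbhs (0 : 'rV[R]_N) V,
      {uniform V, rescale eps @[eps --> 0^'+] --> L},
      forall x, V x -> differentiable L x
    & {uniform V, jacobian (rescale eps) @[eps --> 0^'+] --> jacobian L}].

End Rescaling.

(* Main.v *)
(* Taylor's formula is used with weighted degrees. If f is of class C^m and
   D^a f(0) = 0 whenever the weight of a is at most m, then f = o(eps^m) on
   Box(eps): by induction on m (partial derivatives commute) each d_l f is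
   o(eps^(m - sigma_l)) there, and moving from 0 to x along the coordinate
   axes the mean value theorem multiplies it by |x_l| < eps^sigma_l. When
   sigma_l > m boundedness of d_l f is enough, so no more than C^m is needed.
   If only the derivatives of weight < m vanish, subtract from f the weighted
   homogeneous polynomial p = sum_(weight a = m) D^a f(0) / a! x^a; both f - p
   and its first derivatives are then small, and p commutes with dilations up
   to the factor eps^m, so p is the rescaling limit of f. Conversely, if
   f = O(eps^m), the homogeneous polynomials of weight w < m vanish on Box(1)
   for w = 0, 1, ... in turn, and so do the derivatives at 0 of weight w. *)
Require Import Defs.
From HB Require Import structures.
From mathcomp Require Import all_boot all_order all_algebra.
From mathcomp Require Import all_classical all_reals all_analysis.
From mathcomp Require Import ring lra.
From mathcomp Require Import -(notations) mpoly.

Set Implicit Arguments.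
Unset Strict Implicit.
Unset Printing Implicit Defensive.

Import Order.TTheory GRing.Theory Num.Theory.
Import numFieldNormedType.Exports.

Local Open Scope classical_set_scope.
Local Open Scope ring_scope.

(** * Classes [Ck] and locality of partial derivatives *)

Section Regularity.
Variables (R : realType) (N : nat).
Implicit Types (f g : 'rV[R]_N -> R) (U : set 'rV[R]_N) (i j : 'I_N).

Lemma Ck_continuous m U f x : Ck m U f -> U x -> {for x, continuous f}.
Proof. by case: m => [|m] [cf _]; exact: cf. Qed.

Lemma Ck_derivable m U f i x :
  Ck m.+1 U f -> U x -> derivable f x (delta_mx 0 i).
Proof. by move=> [_ /(_ i)[df _]]; exact: df. Qed.

Lemma Ck_pder m U f i : Ck m.+1 U f -> Ck m U (pder i f).
Proof. by move=> [_ /(_ i)[]]. Qed.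

Lemma Ck_le m n U f : (m <= n)%N -> Ck n U f -> Ck m U f.
Proof.
elim: m n f => [|m IH] [|n] f // mn [cf df]; split => // i.
by have [dfi dfC] := df i; split=> //; exact: IH dfC.
Qed.

Section OpenDomain.
Variable U : set 'rV[R]_N.
Hypothesis oU : open U.

Let eq_near f g x : (forall y, U y -> f y = g y) -> U x ->
  {near x, f =1 g}.
Proof.
by move=> fg Ux; near do apply: fg; exact: open_nbhs_nbhs.
Unshelve. all: by end_near. Qed.

(** Derivatives depend only on the germ of a function. Linearity and symmetry of derivatives are
    known on [U] only, and this form carries them under further derivatives. *)
Lemma eq_pder f g i x : (forall y, U y -> f y = g y) -> U x ->
  pder i f x = pder i g x.
Proof. by move=> fg Ux; apply: near_eq_derive; exact: eq_near. Qed.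

Lemma eq_Dmulti f g a x : (forall y, U y -> f y = g y) -> U x ->
  Dmulti a f x = Dmulti a g x.
Proof.
move=> fg; rewrite /Dmulti; elim: (enum _) x => [|i s IH] x Ux /=; first exact: fg.
elim: (a i) x Ux => [|k IHk] x Ux /=; first exact: IH.
by apply: eq_pder.
Qed.

Let eq_continuous_at f g x : (forall y, U y -> f y = g y) -> U x ->
  {for x, continuous f} -> {for x, continuous g}.
Proof.
move=> fg Ux; rewrite /prop_for /continuous_at -fg//; apply: cvg_trans.
by apply: near_eq_cvg; [exact: nbhs_filter|exact: eq_near].
Qed.

Lemma eq_Ck f g m : (forall x, U x -> f x = g x) -> Ck m U f -> Ck m U g.
Proof.
elim: m f g => [|m IH] f g fg [cf df].
  by split=> // x Ux; exact: eq_continuous_at (cf x Ux).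
split=> [x Ux|i]; first exact: eq_continuous_at (cf x Ux).
have [dfi dfC] := df i; split=> [x Ux|].
  by apply: near_eq_derivable (dfi x Ux); exact: eq_near.
by apply: IH dfC => x; exact: eq_pder.
Qed.

Lemma CkB f g m : Ck m U f -> Ck m U g -> Ck m U (f \- g).
Proof.
elim: m f g => [|m IH] f g [cf df] [cg dg].
  by split=> // x Ux; apply: continuousB; [exact: cf|exact: cg].
split=> [x Ux|i]; first by apply: continuousB; [exact: cf|exact: cg].
have [dfi dfC] := df i; have [dgi dgC] := dg i; split=> [x Ux|].
  by apply: derivableB; [exact: dfi|exact: dgi].
apply: eq_Ck (IH _ _ dfC dgC) => x Ux.
by rewrite /pder deriveB; [|exact: dfi|exact: dgi].
Qed.

End OpenDomain.
End Regularity.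

(** * Polynomial functions *)

Section PolynomialFunctions.
Variables (R : realType) (N : nat).
Implicit Types (p q : mpoly N R) (a : multinom N).

Definition mfun p : 'rV[R]_N -> R := fun x => meval (fun i => x 0 i) p.

(** Constants and variables generate the polynomials as a ring, so the sum and product rules suffice
    below. *)
Lemma mfun_ind (P : mpoly N R -> Prop) :
  (forall c, P (mpolyC N c)) -> (forall i, P (mpolyX R (mnm1 i))) ->
  (forall p q, P p -> P q -> P (p + q)) ->
  (forall p q, P p -> P q -> P (p * q)) -> forall p, P p.
Proof.
move=> PC PX PD PM; elim/mpolyind => [|c a p _ _ Pp]; first exact: PC.
apply: PD => //; rewrite -mul_mpolyC; apply: (PM); first exact: PC.
rewrite mpolyXE_id; apply: (big_ind P) => [||i _]; [exact: (PC 1)|exact: PM|].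
by elim: (a i) => [|k IH]; [exact: (PC 1)|rewrite exprS; exact: PM].
Qed.

Lemma is_derive_mfun i p x :
  is_derive x (delta_mx 0 i) (mfun p) (mfun (mderiv i p) x).
Proof.
elim/mfun_ind: p => [c|j|p q Dp Dq|p q Dp Dq].
- have -> : mfun (mpolyC N c) = cst c by apply/funext => y; rewrite /mfun mevalC.
  by rewrite mderivC /mfun meval0; exact: is_derive_cst.
- have -> : mfun (mpolyX R (mnm1 j)) = fun y => y 0 j.
    by apply/funext => y; rewrite /mfun mevalXU.
  rewrite mderivX /mfun mevalZ.
  (* For [j != i] the truncated [mnm_sub] is multiplied by zero; for [j = i] it is [mnm0]. *)
  have -> : (mnm1 j i)%:R *
      meval (fun k => x 0 k) (mpolyX R (mnm_sub (mnm1 j) (mnm1 i)))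
      = (delta_mx 0 i : 'rV[R]_N) 0 j.
    rewrite mnm1E mxE /=; have [->|_] := eqVneq j i; last by rewrite mul0r.
    by rewrite -{1}[mnm1 i]add0m addmK mpolyX0 meval1 mulr1.
  have cf : derivable (fun y : 'rV[R]_N => y 0 j) x (delta_mx 0 i).
    exact/diff_derivable/differentiable_coord.
  split=> //.
  have := derive_mx (@derivable_id R _ x (delta_mx 0 i)).
  rewrite derive_id => /(congr1 (fun M : 'rV[R]_N => M 0 j)).
  by rewrite [RHS]mxE => <-.
- have -> : mfun (p + q) = mfun p + mfun q.
    by apply/funext => y; rewrite /mfun mevalD.
  by rewrite mderivD /mfun mevalD; exact: is_deriveD.
- have -> : mfun (p * q) = mfun p * mfun q.
    by apply/funext => y; rewrite /mfun mevalM.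
  rewrite mderivM /mfun mevalD !mevalM.
  rewrite addrC [X in _ + X]mulrC; exact: is_deriveM.
Qed.

Lemma pder_mfun i p : pder i (mfun p) = mfun (mderiv i p).
Proof. by apply/funext => x; have [] := is_derive_mfun i p x. Qed.

Lemma differentiable_mfun p x : differentiable (mfun p) x.
Proof.
elim/mfun_ind: p => [c|j|p q Dp Dq|p q Dp Dq].
- have -> : mfun (mpolyC N c) = cst c by apply/funext => y; rewrite /mfun mevalC.
  exact: differentiable_cst.
- have -> : mfun (mpolyX R (mnm1 j)) = fun y => y 0 j.
    by apply/funext => y; rewrite /mfun mevalXU.
  exact: differentiable_coord.
- have -> : mfun (p + q) = mfun p + mfun q.
    by apply/funext => y; rewrite /mfun mevalD.
  exact: differentiableD.
- have -> : mfun (p * q) = mfun p * mfun q.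
    by apply/funext => y; rewrite /mfun mevalM.
  exact: differentiableM.
Qed.

Lemma Ck_mfun m U p : Ck m U (mfun p).
Proof.
have cp q x : {for x, continuous (mfun q)}.
  exact/differentiable_continuous/differentiable_mfun.
elim: m p => [|m IH] p; split=> // i; split; last by rewrite pder_mfun.
by move=> x _; exact/diff_derivable/differentiable_mfun.
Qed.

Lemma Dmulti_mfun a p : Dmulti a (mfun p) = mfun (mderivm a p).
Proof.
rewrite /Dmulti /mderivm; elim: (enum _) => //= i s ->.
by elim: (a i) => //= k ->; rewrite pder_mfun.
Qed.

Lemma mfun0 p : mfun p 0 = mcoeff mnm0 p.
Proof.
elim/mfun_ind: p => [c|j|p q Dp Dq|p q Dp Dq].
- by rewrite /mfun mevalC mcoeffC eqxx mulr1.
- rewrite /mfun mevalXU mxE mcoeffX; case: eqP => // /(congr1 (@mdeg N)).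
  by rewrite mdeg1 mdeg0.
- by rewrite mcoeffD -Dp -Dq /mfun mevalD.
- by rewrite rmorphM /= -Dp -Dq /mfun mevalM.
Qed.

(** After the differentiation only the monomial of exponent [a] survives at 0; this converts
    derivatives at 0 into coefficients and back. *)
Lemma Dmulti_mfun0 a p :
  Dmulti a (mfun p) 0 = mcoeff a p * (\prod_(i < N) (a i)`!)%:R.
Proof.
rewrite Dmulti_mfun mfun0 mcoeff_mderivm addm0 mulr_natr; congr (_ *+ _).
by apply: eq_bigr => i _; rewrite ffactnn.
Qed.

End PolynomialFunctions.

(** * Mean value estimates and differentiability *)

Section MeanValue.
Variables (R : realType) (N : nat).
Implicit Types (f : 'rV[R]_N -> R) (x v z : 'rV[R]_N) (i l : 'I_N).

Lemma is_derive_line f i x (t : R) :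
  derivable f (x + t *: delta_mx 0 i) (delta_mx 0 i) ->
  is_derive t 1 (fun s : R => f (x + s *: delta_mx 0 i))
    (pder i f (x + t *: delta_mx 0 i)).
Proof.
set e := delta_mx 0 i => df.
have E : (fun h : R => h^-1 *: (f (x + (h *: (1 : R) + t) *: e) - f (x + t *: e)))
       = (fun h : R => h^-1 *: (f (h *: e + (x + t *: e)) - f (x + t *: e))).
  apply/funext => h; congr (_ *: (f _ - _)).
  by rewrite -[h *: (1 : R)]/(h * 1) mulr1 scalerDl addrCA.
by apply: DeriveDef; [rewrite /derivable|rewrite /pder /derive]; rewrite /= E.
Qed.

(** Giving the intermediate point as a fraction [t] of [h] makes the mean value theorem on
    coordinate lines insensitive to the sign of [h], with [h = 0] included. *)
Lemma pder_MVT f i x (h : R) :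
  (forall t, 0 <= t <= 1 ->
     derivable f (x + (t * h) *: delta_mx 0 i) (delta_mx 0 i)) ->
  exists2 t, 0 <= t <= 1 & f (x + h *: delta_mx 0 i) - f x =
    h * pder i f (x + (t * h) *: delta_mx 0 i).
Proof.
set e := delta_mx 0 i => df.
pose g (s : R) := f (x + s *: e).
have dg s : (exists2 t, 0 <= t <= 1 & s = t * h) ->
    is_derive s 1 g (pder i f (x + s *: e)).
  by move=> [t t01 ->]; exact/is_derive_line/df.
have cg a b : (forall s, a <= s <= b -> exists2 t, 0 <= t <= 1 & s = t * h) ->
    {within `[a, b], continuous g}.
  move=> ab; apply: derivable_within_continuous => s; rewrite in_itv /= => /ab.
  by move=> /dg[].
have gh : g h = f (x + h *: e) by [].
have g0 : g 0 = f x by rewrite /g scale0r addr0.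
rewrite -gh -g0.
have [h0|h0|->] := ltgtP h 0; last by exists 0; rewrite ?lexx ?ler01// mul0r subrr.
- have inh s : h <= s <= 0 -> exists2 t, 0 <= t <= 1 & s = t * h.
    move=> /andP[hs s0]; exists (s / h); last by rewrite divfK// lt_eqF.
    by rewrite ler_ndivlMr// mul0r s0 ler_ndivrMr// mul1r.
  have [||s sh E] := @MVT_segment R g (fun s => pder i f (x + s *: e)) h 0 (ltW h0).
  + move=> s; rewrite in_itv /= => /andP[hs s0]; apply: dg.
    by apply: inh; rewrite !ltW.
  + exact: cg.
  rewrite in_itv /= in sh.
  have [t t01 st] := inh _ sh; exists t => //.
  by rewrite -st -opprB E sub0r mulrN opprK mulrC.
- have inh s : 0 <= s <= h -> exists2 t, 0 <= t <= 1 & s = t * h.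
    move=> /andP[s0 hs]; exists (s / h); last by rewrite divfK// gt_eqF.
    by rewrite divr_ge0 ?(ltW h0)//= ler_pdivrMr// mul1r.
  have [||s sh E] := @MVT_segment R g (fun s => pder i f (x + s *: e)) 0 h (ltW h0).
  + move=> s; rewrite in_itv /= => /andP[hs s0]; apply: dg.
    by apply: inh; rewrite !ltW.
  + exact: cg.
  rewrite in_itv /= in sh.
  have [t t01 st] := inh _ sh; exists t => //.
  by rewrite -st E subr0 mulrC.
Qed.

(** The closed box with opposite corners [x] and [x + v]; parameters instead of inequalities avoid
    cases on the signs of [v]. *)
Definition rect x v : set 'rV[R]_N :=
  [set z | forall k, exists2 t, 0 <= t <= 1 & z 0 k = x 0 k + t * v 0 k].

(* Move from x to x + v one coordinate at a time. *)
Lemma pder_increment f x v (a c : 'I_N -> R) :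
  (forall z i, rect x v z -> derivable f z (delta_mx 0 i)) ->
  (forall z i, rect x v z -> `|pder i f z - a i| <= c i) ->
  `|f (x + v) - f x - \sum_i v 0 i * a i| <= \sum_i `|v 0 i| * c i.
Proof.
move=> df pc.
pose z (n : nat) : 'rV[R]_N := \row_k (x 0 k + (k < n)%:R * v 0 k).
have zS (i : 'I_N) : z i.+1 = z i + v 0 i *: delta_mx 0 i.
  apply/rowP => k; rewrite !mxE eqxx /= -addrA ltnS leq_eqVlt; congr (_ + _).
  have [->|ki] := eqVneq k i; first by rewrite eqxx ltnn mulr1 mul1r mul0r add0r.
  by rewrite val_eqE (negbTE ki) /= mulr0 addr0.
have zN : z N = x + v by apply/rowP => k; rewrite !mxE ltn_ord mul1r.
have z0 : z 0%N = x by apply/rowP => k; rewrite !mxE mul0r addr0.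
have -> : f (x + v) - f x = \sum_(i < N) (f (z i.+1) - f (z i)).
  by rewrite -(big_mkord xpredT (fun i : nat => f (z i.+1) - f (z i)))
     telescope_sumr// zN z0.
rewrite -sumrB; apply: le_trans (ler_norm_sum _ _ _) _; apply: ler_sum => i _.
(* Coordinates before [i] have moved completely, those after [i] not at all, and coordinate [i] by
   the fraction [t]. *)
have rz (t : R) : 0 <= t <= 1 -> rect x v (z i + (t * v 0 i) *: delta_mx 0 i).
  move=> t01 k; rewrite !mxE eqxx /=; have [->|ki] := eqVneq k i.
    by exists t => //; rewrite ltnn mul0r addr0 mulr1.
  rewrite mulr0 addr0; exists (k < i)%:R => //.
  by case: ltnP; rewrite ?lexx ler01.
have [t t01] := pder_MVT (fun t t01 => df _ i (rz t t01)).
rewrite -zS => ->; rewrite -mulrBr normrM ler_wpM2l//.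
exact/pc/rz.
Qed.

Lemma normr_coord_le x k : `|x 0 k| <= `|x|.
Proof.
rewrite [leRHS]/Num.Def.normr /= mx_normrE; apply/bigmax_geP; right => /=.
by exists (0, k).
Qed.

Lemma ball_rVP x (r : R) z :
  ball x r z <-> 0 < r /\ forall k, `|x 0 k - z 0 k| < r.
Proof.
split=> [[r0 xz]|[r0 xz]]; first by split=> // k; exact: xz.
by split=> // i k; rewrite ord1; exact: xz.
Qed.

Lemma rect_ball x v (r : R) z : ball 0 r v -> rect x v z -> ball x r z.
Proof.
move=> /ball_rVP[r0 vr] xvz; apply/ball_rVP; split=> // k.
have [t /andP[t0 t1] ->] := xvz k.
rewrite opprD addNKr normrN normrM ger0_norm//.
apply: le_lt_trans (vr k); rewrite mxE sub0r normrN.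
by rewrite -[leRHS]mul1r ler_wpM2r.
Qed.

(** The candidate differential, when [c] lists the partial derivatives. *)
Definition lform (c : 'I_N -> R) (v : 'rV[R]_N) : R := \sum_i v 0 i * c i.

Fact lform_linear c : linear (lform c).
Proof.
move=> a u v; rewrite /lform scaler_sumr -big_split /=; apply: eq_bigr => i _.
by rewrite !mxE mulrDl -mulrA.
Qed.

HB.instance Definition _ c :=
  GRing.isLinear.Build R 'rV[R]_N R _ (lform c) (lform_linear c).

Lemma lform_continuous c : continuous (lform c).
Proof.
move=> v; apply: differentiable_continuous.
have -> : lform c = \sum_i (fun u : 'rV[R]_N => c i *: (u 0 i : R)).
  by apply/funext => u; rewrite fct_sumE; apply: eq_bigr => i _; rewrite mulrC.
by apply: differentiable_sum => i; apply/differentiableZ/differentiable_coord.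
Qed.

(** Near [x] all partial derivatives are within [c] of their values at [x], so by [pder_increment]
    the increment differs from [A v] by at most [c] times the sum of the [|v_i|]. *)
Lemma C1_differentiable f x :
  (forall i, \forall y \near x, derivable f y (delta_mx 0 i)) ->
  (forall i, {for x, continuous (pder i f)}) -> differentiable f x.
Proof.
move=> df cf; pose A := lform (fun i => pder i f x).
suff fA : f \o shift x = cst (f x) + A +o_ (0 : 'rV[R]_N) id.
  have dA := @diff_unique R 'rV[R]_N R f A x (@lform_continuous _) fA.
  by apply/diff_locallyP; rewrite dA; split => //; exact: lform_continuous.
apply/eqaddoP => e e0.
(* The [N] coordinates together cost at most [e * |v|]; [N.+1] keeps the divisor nonzero when
   [N = 0]. *)
pose c := e / N.+1%:R.
have c0 : 0 < c by rewrite divr_gt0.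
pose P i z := derivable f z (delta_mx 0 i) /\ `|pder i f z - pder i f x| <= c.
have nP i : \forall z \near x, P i z.
  near=> z; split; first by near: z; exact: df.
  by rewrite distrC; near: z; move/cvgrPdist_le: (cf i); exact.
have [r /= r0 rP] := (nbhs_ballP _ _).1 (filter_forall (nbhs_filter x) nP).
near=> v.
have bv : ball 0 r v by near: v; exact: nbhsx_ballx.
have rB z := @rect_ball x v r z bv.
rewrite -[_ v]/(f (v + x) - (f x + A v)) [v + x]addrC opprD addrA.
apply: (le_trans (pder_increment (c := fun=> c)
  (fun z i zP => (rP _ (rB _ zP) i).1) (fun z i zP => (rP _ (rB _ zP) i).2))).
rewrite -mulr_suml /c mulrCA ler_wpM2l ?(ltW e0)// ler_pdivrMr//.
apply: le_trans (_ : \sum_(i < N) `|v| <= _).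
  by apply: ler_sum => i _; exact: normr_coord_le.
by rewrite sumr_const card_ord -[leLHS]mulr_natr ler_wpM2l// ler_nat.
Unshelve. all: by end_near. Qed.

End MeanValue.

(** * Symmetry of partial derivatives *)

Section Schwarz.
Variables (R : realType) (N : nat).
Implicit Types (f : 'rV[R]_N -> R) (x w : 'rV[R]_N) (i j : 'I_N).

Lemma is_derive_translate f x w v :
  derivable f (x + w) v ->
  is_derive x v (fun y => f (y + w)) ('D_v f (x + w)).
Proof.
move=> df.
have E : (fun h : R => h^-1 *: (f (h *: v + x + w) - f (x + w)))
       = (fun h : R => h^-1 *: (f (h *: v + (x + w)) - f (x + w))).
  by apply/funext => h; rewrite addrA.
by apply: DeriveDef; rewrite /derivable /derive /= E.
Qed.

(* Apply the mean value theorem to y |-> f (y + s e_j) - f y along e_i, then to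
   d_i f along e_j; exchanging i and j gives the same left-hand side. *)
Lemma pder2_MVT U f i j x (r s : R) :
  Ck 2 U f -> ball x r `<=` U -> 0 < s -> s + s < r ->
  exists2 y, ball x r y &
    f (x + s *: delta_mx 0 i + s *: delta_mx 0 j) - f (x + s *: delta_mx 0 i)
      - (f (x + s *: delta_mx 0 j) - f x)
    = s * (s * pder j (pder i f) y).
Proof.
move=> Cf rU s0 sr; set ei := delta_mx 0 i; set ej := delta_mx 0 j.
(* A coordinate moves by at most [s + s < r]; both shifts hit the same coordinate only when
   [i = j]. *)
have in_ball (t u : R) : 0 <= t <= 1 -> 0 <= u <= 1 ->
    ball x r (x + (t * s) *: ei + (u * s) *: ej).
  move=> /andP[t0 t1] /andP[u0 u1]; apply/ball_rVP.
  split; first by apply: lt_trans sr; rewrite addr_gt0.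
  move=> k; rewrite !mxE !eqxx /= -addrA opprD addNKr normrN.
  apply: le_lt_trans sr; apply: le_trans (ler_normD _ _) _.
  by apply: lerD; rewrite normrM ger0_norm ?mulr_ge0 ?(ltW s0)//;
    case: (k == _); rewrite ?normr1 ?normr0 ?mulr1 ?mulr0 ?(ltW s0)//
      ler_piMl ?(ltW s0).
have in01 : 0 <= (1 : R) <= (1 : R) by rewrite ler01 lexx.
have in00 : (0 : R) <= (0 : R) <= (1 : R) by rewrite lexx ler01.
have in_ball0 (t : R) : 0 <= t <= 1 -> ball x r (x + (t * s) *: ei).
  by move=> t01; have := in_ball _ _ t01 in00; rewrite mul0r scale0r addr0.
have in_ball1 (t : R) : 0 <= t <= 1 -> ball x r (x + (t * s) *: ei + s *: ej).
  by move=> t01; have := in_ball _ _ t01 in01; rewrite mul1r.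
pose g y := f (y + s *: ej) - f y.
have dg (t : R) : 0 <= t <= 1 -> is_derive (x + (t * s) *: ei) ei g
    (pder i f (x + (t * s) *: ei + s *: ej) - pder i f (x + (t * s) *: ei)).
  move=> t01; apply: is_deriveB.
    by apply: is_derive_translate; apply: Ck_derivable Cf _; exact/rU/in_ball1.
  by apply: derivableP; apply: Ck_derivable Cf _; exact/rU/in_ball0.
have [t t01] := @pder_MVT R N g i x s
  (fun t t01 => @ex_derive _ _ _ _ _ _ _ (dg t t01)).
rewrite /pder (@derive_val _ _ _ _ _ _ _ (dg t t01)).
have Cif := Ck_pder i Cf.
have [|u u01 ->] := @pder_MVT R N (pder i f) j (x + (t * s) *: ei) s.
  by move=> u u01; apply: Ck_derivable Cif _; exact/rU/in_ball.
move=> E; exists (x + (t * s) *: ei + (u * s) *: ej); first exact: in_ball.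
exact: E.
Qed.

(** One mixed difference has two mean values, so the two mixed derivatives agree at some points [y]
    and [z] arbitrarily near [x]; continuity of the second derivatives brings both back to [x]. *)
Lemma pderC U f i j x : open U -> Ck 2 U f -> U x ->
  pder i (pder j f) x = pder j (pder i f) x.
Proof.
move=> oU Cf Ux.
have [r0 /= r00 r0U] := (nbhs_ballP _ _).1 (open_nbhs_nbhs (conj oU Ux)).
apply/eqP; rewrite -subr_eq0 -normr_le0; apply/ler_addgt0Pr => e e0.
rewrite add0r.
have e20 : 0 < e / 2 by rewrite divr_gt0.
have cij k l : \forall y \near x,
    `|pder k (pder l f) x - pder k (pder l f) y| <= e / 2.
  have := Ck_continuous (Ck_pder k (Ck_pder l Cf)) Ux.
  by move/cvgrPdist_le; exact.
have [r1 /= r10 r1P] := (nbhs_ballP _ _).1 (cij i j).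
have [r2 /= r20 r2P] := (nbhs_ballP _ _).1 (cij j i).
pose r := Num.min r0 (Num.min r1 r2).
have rgt0 : 0 < r by rewrite !lt_min r00 r10.
have rU : ball x r `<=` U.
  by apply: subset_trans r0U; apply: le_ball; rewrite ge_min lexx.
pose s := r / 3.
have s0 : 0 < s by rewrite divr_gt0.
have sr : s + s < r by rewrite /s; lra.
have [y xy Ey] := pder2_MVT i j Cf rU s0 sr.
have [z xz Ez] := pder2_MVT j i Cf rU s0 sr.
have Eyz : pder j (pder i f) y = pder i (pder j f) z.
  have : s * (s * pder j (pder i f) y) = s * (s * pder i (pder j f) z).
    rewrite -Ey -Ez [x + s *: _ + _]addrAC; ring.
  by move/(mulfI (lt0r_neq0 s0))/(mulfI (lt0r_neq0 s0)).
have Hz : `|pder i (pder j f) x - pder i (pder j f) z| <= e / 2.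
  by apply: r1P; apply: le_ball xz; rewrite !ge_min lexx orbT.
have Hy : `|pder j (pder i f) x - pder j (pder i f) y| <= e / 2.
  by apply: r2P; apply: le_ball xy; rewrite !ge_min lexx !orbT.
rewrite Eyz distrC in Hy.
by rewrite (splitr e); apply: le_trans (ler_distD _ _ _) _; exact: lerD Hz Hy.
Qed.

Lemma eq_iter_pder U f g i k x : open U -> (forall y, U y -> f y = g y) -> U x ->
  iter k (pder i) f x = iter k (pder i) g x.
Proof.
move=> oU fg; elim: k x => [|k IH] x Ux; first exact: fg.
exact: (@eq_pder _ _ U oU).
Qed.

Lemma Ck_iter m n U f i : Ck (m + n) U f -> Ck m U (iter n (pder i) f).
Proof.
elim: n f => [|n IHn] f; first by rewrite addn0.
rewrite addnS => Cf; rewrite iterSr; exact/IHn/Ck_pder.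
Qed.

Lemma pder_iter U f i j k x : open U -> Ck k.+1 U f -> U x ->
  pder j (iter k (pder i) f) x = iter k (pder i) (pder j f) x.
Proof.
move=> oU; elim: k f x => [//|k IH] f x Cf Ux.
rewrite iterS (@pderC U)// => [|]; last exact: Ck_iter.
rewrite iterS; apply: (@eq_pder _ _ U oU) Ux => y Uy.
by apply: IH Uy; exact: Ck_le Cf.
Qed.

(** Generalizes [Dmulti] from [enum 'I_N] to any list, to allow induction on the list. *)
Definition pder_seq (b : 'I_N -> nat) (s : seq 'I_N) f : 'rV[R]_N -> R :=
  foldr (fun i g => iter (b i) (pder i) g) f s.

Lemma Ck_pder_seq b s m U f : Ck (m + \sum_(i <- s) b i)%N U f ->
  Ck m U (pder_seq b s f).
Proof.
elim: s m => [|i s IH] m; first by rewrite big_nil addn0.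
by rewrite big_cons addnA /= => Cf; apply: Ck_iter; exact: IH.
Qed.

Lemma pder_pder_seq b s U f l x : open U ->
  Ck (\sum_(i <- s) b i).+1 U f -> U x ->
  pder l (pder_seq b s f) x = pder_seq b s (pder l f) x.
Proof.
move=> oU; elim: s x => [//|i s IH] x; rewrite big_cons -addSn => Cf Ux /=.
rewrite (@pder_iter U)//; last exact: Ck_pder_seq.
apply: (@eq_iter_pder U) => // y Uy; apply: IH Uy.
by apply: Ck_le Cf; rewrite addSn ltnS leq_addl.
Qed.

(** The innermost derivative is commuted outwards until it meets the block of index [l]; since [s]
    has no duplicates, exactly one exponent grows. *)
Lemma pder_seq_pder b s U f l x : uniq s -> l \in s -> open U ->
  Ck (\sum_(i <- s) b i).+1 U f -> U x ->
  pder_seq b s (pder l f) x = pder_seq (fun i => b i + (l == i))%N s f x.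
Proof.
move=> + + oU; elim: s x => [//|i s IH] x; rewrite cons_uniq => /andP[iNs us].
rewrite in_cons big_cons -addSn => ls Cf Ux.
have Cfs : Ck (\sum_(i <- s) b i).+1 U f.
  by apply: Ck_le Cf; rewrite addSn ltnS leq_addl.
rewrite -!/(pder_seq _ (i :: s) _) /=; move: ls.
have [-> _|li /= ls] := eqVneq l i; last first.
  by rewrite addn0; apply: (@eq_iter_pder U) => // y Uy; exact: IH.
have -> : pder_seq (fun j => b j + (i == j))%N s f = pder_seq b s f.
  elim: s iNs {us IH Cf Cfs} => //= j s IH.
  rewrite in_cons negb_or => /andP[ij iNs].
  by rewrite (negbTE ij) addn0 IH.
rewrite addn1 iterSr; apply: (@eq_iter_pder U) => // y Uy.
by rewrite (@pder_pder_seq b s U).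
Qed.

Lemma Dmulti_pder U f l a x : open U -> Ck (mdeg a).+1 U f -> U x ->
  Dmulti a (pder l f) x = Dmulti (mnm_add a (mnm1 l)) f x.
Proof.
move=> oU Cf Ux; rewrite -[LHS]/(pder_seq a (enum 'I_N) (pder l f) x).
rewrite (@pder_seq_pder a _ U) ?enum_uniq ?mem_enum//; last first.
  by move: Cf; rewrite mdegE big_enum.
have E : (fun i => (a i + (l == i))%N) =1 mnm_add a (mnm1 l).
  by move=> i; rewrite mnmDE mnm1E.
rewrite /Dmulti /pder_seq; elim: (enum _) x Ux => //= i s IH x Ux.
by rewrite -E; apply: (@eq_iter_pder U).
Qed.

Lemma iter_pderB k U f g i x : open U -> Ck k U f -> Ck k U g -> U x ->
  iter k (pder i) (f \- g) x = iter k (pder i) f x - iter k (pder i) g x.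
Proof.
move=> oU; elim: k x f g => [//|k IH] x f g Cf Cg Ux.
rewrite !iterSr -IH//; [|exact: Ck_pder..].
apply: (@eq_iter_pder U) => // y Uy.
by rewrite /pder deriveB//; [exact: Ck_derivable Cf Uy|exact: Ck_derivable Cg Uy].
Qed.

Lemma DmultiB a U f g x : open U -> Ck (mdeg a) U f -> Ck (mdeg a) U g -> U x ->
  Dmulti a (f \- g) x = Dmulti a f x - Dmulti a g x.
Proof.
move=> oU; rewrite mdegE -big_enum -[Dmulti a _ _]/(pder_seq a (enum 'I_N) _ x).
rewrite -[Dmulti a f x]/(pder_seq a (enum 'I_N) _ x).
rewrite -[Dmulti a g x]/(pder_seq a (enum 'I_N) _ x).
elim: (enum _) x => [//|i s IH] x; rewrite big_cons => Cf Cg Ux.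
rewrite -[RHS](@iter_pderB (a i) U (pder_seq a s f) (pder_seq a s g))//; first last.
- exact: Ck_pder_seq.
- exact: Ck_pder_seq.
apply: (@eq_iter_pder U) => // y Uy.
by apply: IH => //; [apply: Ck_le Cf|apply: Ck_le Cg]; exact: leq_addl.
Qed.

End Schwarz.

(** * Weighted Taylor estimates *)

Section Boxes.
Variables (R : realType) (N : nat) (sigma : 'I_N -> nat).
Hypothesis sigma_gt0 : forall k, (0 < sigma k)%N.
Implicit Types (x : 'rV[R]_N).

(** Real powers with positive exponent are increasing on nonnegative numbers; from here on only
    integer powers of the radius occur. *)
Lemma BoxP (r : R) x : 0 < r ->
  Box sigma r x <-> forall k, `|x 0 k| < r ^+ sigma k.
Proof.
move=> r0.
have coord k : (`|x 0 k| `^ (sigma k)%:R^-1 < r) = (`|x 0 k| < r ^+ sigma k).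
  have s0 : 0 < (sigma k)%:R^-1 :> R by rewrite invr_gt0 ltr0n.
  have rE : r = (r ^+ sigma k) `^ (sigma k)%:R^-1.
    by rewrite -powR_mulrn ?(ltW r0)// -powRrM divff ?powRr1 ?(ltW r0)//
      pnatr_eq0 -lt0n.
  have rs0 : 0 <= r ^+ sigma k by rewrite exprn_ge0// ltW.
  rewrite [in LHS]rE; apply/idP/idP; last first.
    by move=> xr; apply: gt0_ltr_powR => //; rewrite in_itv /= ?normr_ge0 ?rs0.
  apply: contraLR; rewrite -!leNgt => rx.
  by apply: ge0_ler_powR => //; rewrite ?(ltW s0)// nnegrE.
rewrite /Box /mkset /hnorm; split.
  by move=> /bigmax_ltP[_ xr] k; rewrite -coord; exact: xr.
by move=> xr; apply/bigmax_ltP; split=> // k _; rewrite coord.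
Qed.

(** For [eps <= 1] positive weights give [eps ^+ sigma k <= eps], so the box lies in the ball of the
    same radius. *)
Lemma near_Box (P : set 'rV[R]_N) : nbhs (0 : 'rV[R]_N) P ->
  \forall eps \near 0^'+, Box sigma eps `<=` P.
Proof.
move=> /nbhs_ballP[r /= r0 rP].
near=> eps => x.
have e0 : 0 < eps by [].
move=> /BoxP -/(_ e0) xe; apply: rP; apply/ball_rVP; split=> // k.
rewrite mxE sub0r normrN; apply: lt_le_trans (xe k) _.
have e1 : eps <= 1 by near: eps; exact: nbhs_right_le.
have er : eps <= r by near: eps; exact: nbhs_right_le.
apply: le_trans er; rewrite -[leRHS]expr1; exact: ler_wiXn2l.
Unshelve. all: by end_near. Qed.

Lemma rect_Box (eps : R) x z : 0 < eps -> Box sigma eps x -> rect 0 x z ->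
  Box sigma eps z.
Proof.
move=> e0 /BoxP -/(_ e0) xe xz; apply/BoxP => // k.
apply: le_lt_trans (xe k); have [t /andP[t0 t1] ->] := xz k.
by rewrite mxE add0r normrM ger0_norm// ler_piMl.
Qed.

Lemma dil_Box (eps r : R) x : 0 < eps -> 0 < r ->
  Box sigma r x -> Box sigma (eps * r) (dil sigma eps x).
Proof.
move=> e0 r0 /BoxP -/(_ r0) xr; apply/BoxP => [|k]; first exact: mulr_gt0.
rewrite mxE normrM ger0_norm ?exprn_ge0 ?(ltW e0)// exprMn.
by rewrite ltr_pM2l ?exprn_gt0.
Qed.

Lemma weightD a b :
  weight sigma (mnm_add a b) = (weight sigma a + weight sigma b)%N.
Proof.
by rewrite /weight -big_split /=; apply: eq_bigr => i _; rewrite mnmDE mulnDr.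
Qed.

Lemma weight1 l : weight sigma (mnm1 l) = sigma l.
Proof.
rewrite /weight (bigD1 l)//= mnm1E eqxx muln1 big1 ?addn0// => i il.
by rewrite mnm1E eq_sym (negbTE il) muln0.
Qed.

Lemma weight0 : weight sigma (@mnm0 N) = 0%N.
Proof. by rewrite /weight big1// => i _; rewrite mnm0E muln0. Qed.

(** As weights are at least 1, class C^m covers every derivative of weight at most [m]. *)
Lemma mdeg_le_weight a : (mdeg a <= weight sigma a)%N.
Proof. by rewrite mdegE; apply: leq_sum => i _; rewrite leq_pmull. Qed.

End Boxes.

(** * Remainder estimates on shrinking boxes *)

Section Remainder.
Variables (R : realType) (N : nat) (sigma : 'I_N -> nat).
Hypothesis sigma_gt0 : forall k, (0 < sigma k)%N.
Variable U : set 'rV[R]_N.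
Hypotheses (oU : open U) (U0 : U 0).
Implicit Types (f g : 'rV[R]_N -> R) (x : 'rV[R]_N).

Definition box_littleo m g := forall eta : R, 0 < eta ->
  \forall eps \near 0^'+, forall x, Box sigma eps x -> `|g x| <= eta * eps ^+ m.

(* All derivatives at 0 of weight at most m vanish, including f itself. *)
Definition flat m f := forall a, (weight sigma a <= m)%N -> Dmulti a f 0 = 0.

Lemma Dmulti0 f : Dmulti (@mnm0 N) f = f.
Proof.
rewrite /Dmulti; elim: (enum _) => //= i s ->.
by rewrite mnm0E.
Qed.

(** A derivative along [l] adds [sigma l] to the weight and 1 to the order; since [sigma l >= 1],
    the order stays within [m]. *)
Lemma flat_pder m f l : (sigma l <= m)%N -> Ck m U f -> flat m f ->
  flat (m - sigma l) (pder l f).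
Proof.
move=> lm Cf ff a am.
have wm : (weight sigma a + sigma l <= m)%N by rewrite addnC -leq_subRL.
rewrite (@Dmulti_pder _ _ U)//; first by apply: ff; rewrite weightD weight1.
apply: Ck_le Cf; apply: leq_trans wm; rewrite -addn1.
exact: leq_add (mdeg_le_weight _ _) (sigma_gt0 _).
Qed.

(** The little-o of [pder l f] is an assumption, so that the lemma serves both inside the induction
    for [f] and, afterwards, for the final bound on derivatives. *)
Lemma flat_pder_bound m f l : (0 < m)%N -> Ck m U f -> flat m f ->
  ((sigma l <= m)%N -> box_littleo (m - sigma l) (pder l f)) ->
  forall eta : R, 0 < eta -> \forall eps \near 0^'+, forall x,
    Box sigma eps x -> eps ^+ sigma l * `|pder l f x| <= eta * eps ^+ m.
Proof.
case: m => // m _ Cf ff IH eta eta0.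
case: (leqP (sigma l) m.+1) => [lm|ml].
  near=> eps => x xe.
  have e0 : 0 < eps by [].
  rewrite -(subnK lm) exprD mulrA mulrC ler_pM2r ?exprn_gt0//.
  by move: x xe; near: eps; exact: IH.
have := Ck_continuous (Ck_pder l Cf) U0.
move=> /cvgrPdist_le/(_ _ ltr01) /(near_Box sigma_gt0) nb.
(* Here [sigma l >= m.+2], so a bound [M] on the derivative leaves a spare factor [eps], and
   [eps <= eta / M] is enough. *)
pose M := `|pder l f 0| + 1.
have M0 : 0 < M by rewrite ltr_wpDl.
near=> eps => x xe.
have e0 : 0 < eps by [].
have e1 : eps <= 1 by near: eps; exact: nbhs_right_le.
have pM : `|pder l f x| <= M.
  rewrite -lerBlDl; apply: le_trans (lerB_dist _ _) _; rewrite distrC.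
  by move: x xe; near: eps.
apply: le_trans (_ : eps ^+ m.+2 * M <= _).
  apply: ler_pM; rewrite ?exprn_ge0 ?(ltW e0)//.
  by apply: ler_wiXn2l => //; exact: ltW.
rewrite [eps ^+ m.+2]exprS mulrAC ler_pM2r ?exprn_gt0// -ler_pdivlMr//.
by near: eps; apply: nbhs_right_le; rewrite divr_gt0.
Unshelve. all: by end_near. Qed.

Theorem flat_box_littleo m f : Ck m U f -> flat m f -> box_littleo m f.
Proof.
(* Strong induction, because a derivative along [l] lowers [m] by [sigma l]; for [m = 0] continuity
   and [f 0 = 0] conclude. *)
elim/ltn_ind: m f => -[_|m IH] f Cf ff eta eta0.
  have f0 : f 0 = 0.
    by rewrite -[f]Dmulti0; apply: ff; rewrite weight0.
  have := Ck_continuous Cf U0; move=> /cvgrPdist_le/(_ _ eta0) /(near_Box sigma_gt0).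
  apply: filterS => eps xP x /xP /=; rewrite f0 sub0r normrN.
  by rewrite expr0 mulr1.
have f0 : f 0 = 0.
  by rewrite -[f]Dmulti0; apply: ff; rewrite weight0.
pose c := eta / N.+1%:R.
have c0 : 0 < c by rewrite divr_gt0.
have pc i : \forall eps \near 0^'+, forall x, Box sigma eps x ->
    eps ^+ sigma i * `|pder i f x| <= c * eps ^+ m.+1.
  apply: flat_pder_bound => // im; apply: IH; last exact: flat_pder.
    by rewrite ltn_subrL sigma_gt0.
  by apply: Ck_le (Ck_pder i Cf); rewrite leq_subLR -addn1 addnC leq_add2r.
have pcN := filter_forall (at_right_proper_filter 0) pc.
have nU := near_Box sigma_gt0 (open_nbhs_nbhs (conj oU U0)).
near=> eps => x xe.
have e0 : 0 < eps by [].
have BU : Box sigma eps `<=` U by near: eps.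
(* The [- 0] selects the zero linear form in [pder_increment]: only the sizes of the derivatives
   enter. *)
have Pp z i : Box sigma eps z ->
    `|pder i f z - 0| <= c * eps ^+ m.+1 / eps ^+ sigma i.
  rewrite subr0 ler_pdivlMr ?exprn_gt0// mulrC => zB.
  by move: i z zB; near: eps.
have zB z := @rect_Box _ _ _ sigma_gt0 eps x z e0 xe.
have := pder_increment (fun z i zR => Ck_derivable Cf (BU _ (zB z zR)))
  (fun z i zR => Pp z i (zB z zR)).
rewrite add0r f0 subr0 big1 ?subr0 => [|i _]; last by rewrite mulr0.
move/le_trans; apply.
apply: le_trans (_ : \sum_(i < N) c * eps ^+ m.+1 <= _).
  apply: ler_sum => i _; rewrite mulrCA ler_piMr//.
    by apply: mulr_ge0; [exact: ltW|exact/exprn_ge0/ltW].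
  rewrite ler_pdivrMr ?exprn_gt0// mul1r ltW//.
  by move: xe => /BoxP; exact.
rewrite sumr_const card_ord -mulr_natr mulrAC ler_wpM2r ?exprn_ge0 ?(ltW e0)//.
rewrite /c -mulrA ler_piMr ?(ltW eta0)// mulrC ler_pdivrMr// mul1r ler_nat.
exact: leqnSn.
Unshelve. all: by end_near. Qed.

Theorem flat_pder_box_littleo m f l : (0 < m)%N -> Ck m U f -> flat m f ->
  forall eta : R, 0 < eta -> \forall eps \near 0^'+, forall x,
    Box sigma eps x -> eps ^+ sigma l * `|pder l f x| <= eta * eps ^+ m.
Proof.
case: m => // m _ Cf ff; apply: flat_pder_bound => // lm.
apply: flat_box_littleo; last exact: flat_pder.
by apply: Ck_le (Ck_pder l Cf); rewrite leq_subLR -addn1 addnC leq_add2r.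
Qed.

End Remainder.

(** * Rescaling *)

Section Rescaling.
Variables (R : realType) (N : nat) (sigma : 'I_N -> nat).
Hypothesis sigma_gt0 : forall k, (0 < sigma k)%N.
Implicit Types (f g : 'rV[R]_N -> R) (x : 'rV[R]_N) (p : mpoly N R).

Lemma differentiable_rV n m (F : 'rV[R]_n -> 'rV[R]_m) (x : 'rV[R]_n) :
  (forall k, differentiable (fun y => F y 0 k) x) -> differentiable F x.
Proof.
move=> dF.
have -> : F = \sum_k (fun y => F y 0 k *: delta_mx 0 k).
  by apply/funext => y; rewrite fct_sumE [LHS]row_sum_delta.
by apply: differentiable_sum => k; exact: differentiableZl.
Qed.

Lemma jacobianE n m (F : 'rV[R]_n -> 'rV[R]_m) (x : 'rV[R]_n) l k :
  differentiable F x ->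
  jacobian F x l k = pder l (fun y => F y 0 k) x.
Proof.
move=> dF; have := deriveEjacobian (delta_mx 0 l) dF.
rewrite derive_mx; last exact: diff_derivable.
by rewrite -rowE => /rowP/(_ k); rewrite !mxE => <-.
Qed.

Lemma differentiable_dil (eps : R) x : differentiable (dil sigma eps) x.
Proof.
apply: differentiable_rV => k.
have -> : (fun y : 'rV[R]_N => dil sigma eps y 0 k) =
    (fun y => eps ^+ sigma k *: (y 0 k : R)).
  by apply/funext => y; rewrite mxE.
exact/differentiableZ/differentiable_coord.
Qed.

Fact dil_linear (eps : R) : linear (@dil R N sigma eps).
Proof.
by move=> a u v; apply/rowP => k; rewrite !mxE mulrDr mulrCA.
Qed.

HB.instance Definition _ eps :=
  GRing.isLinear.Build R 'rV[R]_N 'rV[R]_N _ (dil sigma eps) (dil_linear eps).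

Lemma is_derive_dil f l (eps : R) x : differentiable f (dil sigma eps x) ->
  is_derive x (delta_mx 0 l) (f \o dil sigma eps)
    (eps ^+ sigma l * pder l f (dil sigma eps x)).
Proof.
move=> df; have ddil := differentiable_dil eps x.
have dfd := differentiable_comp ddil df.
apply: DeriveDef; first exact: diff_derivable.
have dilE : 'd (dil sigma eps) x = dil sigma eps :> ('rV[R]_N -> 'rV[R]_N).
  apply: diff_lin => y; exact/differentiable_continuous/differentiable_dil.
rewrite deriveE// diff_comp//= dilE.
have -> : dil sigma eps (delta_mx 0 l) = eps ^+ sigma l *: delta_mx 0 l.
  apply/rowP => k; rewrite !mxE eqxx /=; have [->//|] := eqVneq k l.
  by rewrite !mulr0.
by rewrite linearZ /pder deriveE.
Qed.

Definition taylor_coef m f a : R :=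
  if weight sigma a == m then Dmulti a f 0 / (\prod_(i < N) (a i)`!)%:R else 0.

(** With positive weights the degree is at most the weight, so degrees up to [m] include every
    multiindex of weight [m]. *)
Definition taylor_part m f : mpoly N R :=
  \sum_(a : bmultinom N m.+1) taylor_coef m f a *: mpolyX R a.

(** In weight [m] the factorials in [taylor_coef] make the derivatives match; in lower weight both
    vanish. *)
Lemma flat_sub_taylor (U : set 'rV[R]_N) m f : open U -> U 0 -> Ck m U f ->
  (forall a, (weight sigma a < m)%N -> Dmulti a f 0 = 0) ->
  flat sigma m (f \- mfun (taylor_part m f)).
Proof.
move=> oU U0 Cf f0 a am.
have Ca : Ck (mdeg a) U f.
  by apply: Ck_le Cf; exact: leq_trans (mdeg_le_weight sigma_gt0 _) am.
rewrite (@DmultiB _ _ _ U)//; last exact: Ck_mfun.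
rewrite Dmulti_mfun0 mcoeff_mpoly; last first.
  by rewrite ltnS; exact: leq_trans (mdeg_le_weight sigma_gt0 _) am.
rewrite /taylor_coef; case: eqVneq => [_|wm].
  rewrite divfK ?subrr// pnatr_eq0 -lt0n prodn_gt0// => i.
  exact: fact_gt0.
by rewrite mul0r subr0 f0// ltn_neqAle wm.
Qed.

Lemma mfun_taylor_dil m f eps x :
  mfun (taylor_part m f) (dil sigma eps x) = eps ^+ m * mfun (taylor_part m f) x.
Proof.
rewrite /mfun !raddf_sum /= mulr_sumr; apply: eq_bigr => a _.
rewrite !mevalZ !mevalX /taylor_coef.
case: eqP => [am|_]; last by rewrite !mul0r mulr0.
rewrite mulrCA; congr (_ * _); rewrite -[X in eps ^+ X]am.
rewrite /weight -prodrXr -big_split /=; apply: eq_bigr => i _.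
by rewrite mxE exprMn exprM.
Qed.

(** Both sides compute the [l]-derivative of the polynomial composed with the dilation: by the chain
    rule and by homogeneity. *)
Lemma mderiv_taylor_dil m f l eps x :
  eps ^+ sigma l * mfun (mderiv l (taylor_part m f)) (dil sigma eps x) =
  eps ^+ m * mfun (mderiv l (taylor_part m f)) x.
Proof.
rewrite -!pder_mfun.
have [_ <-] := @is_derive_dil (mfun (taylor_part m f)) l eps x
  (differentiable_mfun _ _).
have -> : mfun (taylor_part m f) \o dil sigma eps =
    eps ^+ m \*o mfun (taylor_part m f).
  by apply/funext => y; rewrite /= mfun_taylor_dil.
by rewrite deriveMl//; exact/diff_derivable/differentiable_mfun.
Qed.

End Rescaling.

(** * Entrywise uniform convergence and right neighborhoods of 0 *)

Lemma uniform_mxP (R : realType) (T : choiceType) (m n : nat) (V : set T)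
    (I : Type) (G : set_system I) (F : I -> T -> 'M[R]_(m, n))
    (L : T -> 'M[R]_(m, n)) : Filter G ->
  {uniform V, F i @[i --> G] --> L} <->
  forall eta : R, 0 < eta -> \forall i \near G, forall x, V x ->
    forall k l, `|L x k l - F i x k l| < eta.
Proof.
move=> FG; split=> [cF eta eta0|cF P /uniform_nbhs[E [entE EP]]].
  have cP : nbhs (L : {uniform` V -> 'M[R]_(m, n)})
      [set h | forall x, V x -> ball (L x) eta (h x)].
    apply/uniform_nbhs; exists [set xy | ball xy.1 eta xy.2]; split => //.
    exact: entourage_ball (PosNum eta0).
  have : \forall i \near G, forall x, V x -> ball (L x) eta (F i x) by exact: cF cP.
  by apply: filterS => i Fi x /Fi[_ Fx] k l; exact: Fx.
move: entE; rewrite -entourage_ballE => -[eta /= eta0 etaE].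
have := cF _ eta0; apply: filterS => i Fi; apply: EP => x Vx; apply: etaE => /=.
by split => // k l; exact: Fi.
Qed.

Lemma at_right0P (R : realType) (P : set R) :
  (\forall e \near 0^'+, P e) <->
  exists2 d : R, 0 < d & forall e, 0 < e < d -> P e.
Proof.
split=> [|[d d0 dP]].
  move=> [d /= d0 dP]; exists d => // e /andP[e0 ed]; apply: dP => //=.
  by rewrite sub0r normrN gtr0_norm.
by near=> e; apply: dP; apply/andP; split; near: e;
  [exact: nbhs_right_gt|exact: nbhs_right_lt].
Unshelve. all: by end_near. Qed.

(** * The four conditions and the polynomial limit *)

Section Equivalences.
Variables (R : realType) (N : nat) (sigma : 'I_N -> nat).
Hypothesis sigma_gt0 : forall k, (0 < sigma k)%N.
Variable U : set 'rV[R]_N.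
Hypotheses (oU : open U) (U0 : U 0).
Implicit Types (f : 'rV[R]_N -> R) (x : 'rV[R]_N).

Lemma ball_Box : ball (0 : 'rV[R]_N) 1 `<=` Box sigma 1.
Proof.
move=> x /ball_rVP[_ x1]; apply/BoxP => // k; rewrite expr1n.
by have := x1 k; rewrite mxE sub0r normrN.
Qed.

(** Let [p] be the part of weight [w < m], lower derivatives being known to vanish. By homogeneity
    [eps ^+ w * p(x)] is [p] at the dilated point, where [f - p] is o of [eps ^+ w] and [f] is O of
    [eps ^+ m]. So [p] vanishes near 0, and its derivatives of weight [w] at 0 are those of [f]. *)
Lemma bigO_Dmulti0 m f (C : R) : Ck m U f ->
  (\forall eps \near 0^'+, forall x, Box sigma eps x ->
     `|f x| <= C * eps ^+ m) ->
  forall a, (weight sigma a < m)%N -> Dmulti a f 0 = 0.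
Proof.
move=> Cf fO a; move wE : (weight sigma a) => w.
elim/ltn_ind: w a wE => w IH a aw wm.
have Cwf : Ck w U f by apply: Ck_le Cf; exact: ltnW.
have fw b : (weight sigma b < w)%N -> Dmulti b f 0 = 0.
  by move=> bw; apply: (IH _ bw b) => //; exact: ltn_trans wm.
set p := taylor_part sigma w f.
have hflat : flat sigma w (f \- mfun p) by exact: flat_sub_taylor Cwf fw.
have Ch : Ck w U (f \- mfun p) by apply: CkB => //; exact: Ck_mfun.
have ho := flat_box_littleo sigma_gt0 oU U0 Ch hflat.
have p0 x : ball 0 1 x -> mfun p x = mfun 0 x.
  move=> /ball_Box x1; rewrite [RHS]meval0.
  apply/eqP; rewrite -normr_le0; apply/ler_addgt0Pr => e e0; rewrite add0r.
  have e20 : 0 < e / 2 by rewrite divr_gt0.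
  have hoe := ho _ e20.
  near (0 : R)^'+ => eps.
  have eps0 : 0 < eps by [].
  have eps1 : eps <= 1 by near: eps; exact: nbhs_right_le.
  have de : Box sigma eps (dil sigma eps x).
    by rewrite -[eps in Box _ eps]mulr1; exact: dil_Box.
  have fe : `|f (dil sigma eps x)| <= C * eps ^+ m.
    by move: (dil _ _ _) de; near: eps.
  have he : `|f (dil sigma eps x) - mfun p (dil sigma eps x)| <= e / 2 * eps ^+ w.
    by move: (dil _ _ _) de; near: eps.
  (* As [m >= w.+1], one factor [eps] absorbs the constant; [|C| + 1] is positive whatever [C]
     is. *)
  have CM : C * eps ^+ m <= e / 2 * eps ^+ w.
    apply: le_trans (_ : (`|C| + 1) * eps * eps ^+ w <= _).
      rewrite -(subnK wm) addnS -addSn exprD mulrA ler_pM2r ?exprn_gt0//.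
      apply: le_trans (_ : (`|C| + 1) * eps ^+ (m - w.+1).+1 <= _).
        rewrite ler_wpM2r ?exprn_ge0 ?(ltW eps0)//.
        by apply: le_trans (ler_norm _) _; rewrite lerDl.
      rewrite ler_wpM2l ?addr_ge0//.
      by rewrite -[leRHS]expr1; exact: ler_wiXn2l.
    rewrite ler_pM2r ?exprn_gt0// mulrC -ler_pdivlMr ?ltr_wpDl//.
    by near: eps; apply: nbhs_right_le; rewrite divr_gt0// ltr_wpDl.
  rewrite -(ler_pM2r (exprn_gt0 w eps0)).
  rewrite -[X in `|mfun _ _| * X]gtr0_norm ?exprn_gt0//.
  rewrite -normrM mulrC -mfun_taylor_dil -/p (splitr e) mulrDl.
  rewrite -[mfun p _](subKr (f (dil sigma eps x))).
  by apply: le_trans (ler_normB _ _) _; apply: lerD => //; exact: le_trans fe CM.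
have := hflat a; rewrite aw leqnn => /(_ isT).
have am : (mdeg a <= w)%N by rewrite -aw; exact: mdeg_le_weight.
rewrite (@DmultiB _ _ _ U)//; [|exact: Ck_le Cwf|exact: Ck_mfun].
have ob : open (ball (0 : 'rV[R]_N) 1) by exact: ball_open.
rewrite (@eq_Dmulti _ _ _ ob _ _ a 0 p0); last exact: ballxx.
by rewrite Dmulti_mfun0 mcoeff0 mul0r subr0.
Unshelve. all: by end_near. Qed.

Section Limit.
Variables (m : nat) (f : 'rV[R]_N -> R).
Hypotheses (Cf : Ck m U f)
  (f0 : forall a, (weight sigma a < m)%N -> Dmulti a f 0 = 0).
Let p := taylor_part sigma m f.

(** The remainder is o of [(eps * r) ^+ m] on the dilated box. The radius is arbitrary because the
    limit must later be identified at every point of a given [V]. *)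
Lemma rescale_taylor (r eta : R) : 0 < r -> 0 < eta ->
  \forall eps \near 0^'+, forall x, Box sigma r x ->
    `|mfun p x - eps^-1 ^+ m * f (dil sigma eps x)| < eta.
Proof.
move=> r0 eta0.
have Ch : Ck m U (f \- mfun p) by apply: CkB => //; exact: Ck_mfun.
have ho := flat_box_littleo sigma_gt0 oU U0 Ch (flat_sub_taylor sigma_gt0 oU U0 Cf f0).
(* Makes [c * (eps * r) ^+ m] equal to [eta / 2 * eps ^+ m]; the half yields the strict
   inequality. *)
pose c := eta / 2 / r ^+ m.
have c0 : 0 < c by rewrite !divr_gt0// exprn_gt0.
have /at_right0P[d d0 dP] := ho _ c0.
apply/at_right0P; exists (d / r); first by rewrite divr_gt0.
move=> eps /andP[e0 ed] x xr.
have er : 0 < eps * r < d by rewrite mulr_gt0//= -ltr_pdivlMr.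
have := dP _ er _ (dil_Box sigma_gt0 e0 r0 xr).
rewrite /= mfun_taylor_dil -/p => H.
have em : eps ^+ m != 0 by rewrite expf_neq0// gt_eqF.
rewrite -(ltr_pM2r (exprn_gt0 m e0)) -{1}[eps ^+ m]gtr0_norm ?exprn_gt0//.
rewrite -normrM mulrBl exprVn mulrAC mulVf// mul1r distrC mulrC.
apply: le_lt_trans H _; rewrite exprMn mulrCA /c divfK.
  by rewrite mulrC ltr_pM2r ?exprn_gt0//; lra.
by rewrite expf_neq0// gt_eqF.
Qed.

(** Derivatives of [p] scale exactly, so the error is the rescaled derivative of the flat
    remainder. *)
Lemma rescale_pder_taylor l (eta : R) : (0 < m)%N -> 0 < eta ->
  \forall eps \near 0^'+, forall x, Box sigma 1 x ->
    `|mfun (mderiv l p) x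
      - eps^-1 ^+ m * (eps ^+ sigma l * pder l f (dil sigma eps x))| < eta.
Proof.
move=> m0 eta0.
have Ch : Ck m U (f \- mfun p) by apply: CkB => //; exact: Ck_mfun.
have hf := flat_sub_taylor sigma_gt0 oU U0 Cf f0.
have e20 : 0 < eta / 2 by rewrite divr_gt0.
have ho := flat_pder_box_littleo sigma_gt0 oU U0 l m0 Ch hf e20.
have nU := near_Box sigma_gt0 (open_nbhs_nbhs (conj oU U0)).
near=> eps => x x1.
have e0 : 0 < eps by [].
have de : Box sigma eps (dil sigma eps x).
  by rewrite -[eps in Box _ eps]mulr1; exact: dil_Box.
have Ux : U (dil sigma eps x) by move: (dil _ _ _) de; near: eps.
have : eps ^+ sigma l * `|pder l (f \- mfun p) (dil sigma eps x)|
    <= eta / 2 * eps ^+ m by move: (dil _ _ _) de; near: eps.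
have C1f : Ck 1 U f by exact: Ck_le Cf.
rewrite {1}/pder deriveB; first last.
- exact/diff_derivable/differentiable_mfun.
- exact: Ck_derivable C1f Ux.
rewrite -!/(pder _ _ _) pder_mfun -{1}[eps ^+ sigma l]gtr0_norm ?exprn_gt0//.
rewrite -normrM mulrBr mderiv_taylor_dil -/p => H.
have em : eps ^+ m != 0 by rewrite expf_neq0// gt_eqF.
rewrite -(ltr_pM2r (exprn_gt0 m e0)) -{1}[eps ^+ m]gtr0_norm ?exprn_gt0//.
rewrite -normrM mulrBl exprVn mulrAC mulVf// mul1r distrC [mfun _ _ * _]mulrC.
by apply: le_lt_trans H _; rewrite ltr_pM2r ?exprn_gt0//; lra.
Unshelve. all: by end_near. Qed.

End Limit.

Variable Phi : 'rV[R]_N -> 'rV[R]_N.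
Hypothesis Phi_Ck : forall k, Ck (sigma k) U (fun x => Phi x 0 k).

Lemma rescale_coordE eps x k : rescale sigma Phi eps x 0 k =
  eps^-1 ^+ sigma k * Phi (dil sigma eps x) 0 k.
Proof. by rewrite mxE. Qed.

Lemma Phi_differentiable x k : U x ->
  differentiable (fun y => Phi y 0 k) x.
Proof.
move=> Ux; have C1 : Ck 1 U (fun y => Phi y 0 k) by exact: Ck_le (Phi_Ck k).
apply: C1_differentiable => i; last exact: Ck_continuous (Ck_pder i C1) Ux.
have : \forall y \near x, U y by exact: open_nbhs_nbhs.
by apply: filterS => y; exact: Ck_derivable C1.
Qed.

Lemma jacobian_rescale eps x l k : U (dil sigma eps x) ->
  jacobian (rescale sigma Phi eps) x l k = eps^-1 ^+ sigma k *
    (eps ^+ sigma l * pder l (fun y => Phi y 0 k) (dil sigma eps x)).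
Proof.
move=> Ux.
have dP k' := is_derive_dil l (Phi_differentiable k' Ux).
have E k' : (fun y => rescale sigma Phi eps y 0 k') =
    eps^-1 ^+ sigma k' \*o ((fun y => Phi y 0 k') \o dil sigma eps).
  by apply/funext => y; exact: rescale_coordE.
rewrite jacobianE; last first.
  apply: differentiable_rV => k'; rewrite E.
  apply: differentiableZ; apply: differentiable_comp.
    exact: differentiable_dil.
  exact: Phi_differentiable.
by rewrite E /pder deriveMl; [rewrite (@derive_val _ _ _ _ _ _ _ (dP k))|].
Qed.

Definition taylor_map x : 'rV[R]_N :=
  \row_k mfun (taylor_part sigma (sigma k) (fun y => Phi y 0 k)) x.

Lemma taylor_mapE k : (fun y => taylor_map y 0 k) =
  mfun (taylor_part sigma (sigma k) (fun y => Phi y 0 k)).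
Proof. by apply/funext => y; rewrite mxE. Qed.

Lemma differentiable_taylor_map x : differentiable taylor_map x.
Proof.
by apply: differentiable_rV => k; rewrite taylor_mapE; exact: differentiable_mfun.
Qed.

(** The unit ball lies in [Box sigma 1], where both convergence lemmas apply; for small [eps] the
    dilated points lie in [U], where the Jacobian is given by partial derivatives. *)
Lemma rescaling_limit_taylor :
  (forall (k : 'I_N) a, (weight sigma a < sigma k)%N ->
     Dmulti a (fun x => Phi x 0 k) 0 = 0) ->
  rescaling_limit sigma Phi (ball 0 1) taylor_map.
Proof.
move=> Phi0; split.
- by split; [exact: ball_open|exact: ballxx].
- apply/uniform_mxP => eta eta0.
  have H k := rescale_taylor (Phi_Ck k) (@Phi0 k) ltr01 eta0.
  have := filter_forall (at_right_proper_filter 0) H.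
  apply: filterS => eps He x /ball_Box xB i k.
  by rewrite ord1 rescale_coordE mxE; exact: He.
- by move=> x _; exact: differentiable_taylor_map.
apply/uniform_mxP => eta eta0.
have H k l := rescale_pder_taylor (Phi_Ck k) (@Phi0 k) l (sigma_gt0 k) eta0.
have := filter_forall (at_right_proper_filter 0)
  (fun k => filter_forall (at_right_proper_filter 0) (H k)).
have nU := near_Box sigma_gt0 (open_nbhs_nbhs (conj oU U0)).
move=> nH; near=> eps => x /ball_Box xB l k.
have e0 : 0 < eps by [].
have de : Box sigma eps (dil sigma eps x).
  by rewrite -[eps in Box _ eps]mulr1; exact: dil_Box.
have Ux : U (dil sigma eps x) by move: (dil _ _ _) de; near: eps.
rewrite [X in `|_ - X|](jacobian_rescale l k Ux).
rewrite [X in `|X - _|](jacobianE l k (differentiable_taylor_map x)).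
rewrite taylor_mapE pder_mfun.
by have := near nH eps; apply.
Unshelve. all: by end_near. Qed.

(** Pointwise limits are unique, and the box of radius [hnorm sigma x + 1] contains [x]. *)
Lemma rescaling_limit_eq_taylor V L :
  (forall (k : 'I_N) a, (weight sigma a < sigma k)%N ->
     Dmulti a (fun x => Phi x 0 k) 0 = 0) ->
  rescaling_limit sigma Phi V L -> forall x, V x -> L x = taylor_map x.
Proof.
move=> Phi0 [_ /uniform_mxP cL _ _] x Vx; apply/rowP => k; rewrite mxE.
apply/eqP; rewrite -subr_eq0 -normr_le0; apply/ler_addgt0Pr => e e0; rewrite add0r.
have e20 : 0 < e / 2 by rewrite divr_gt0.
have r0 : 0 < hnorm sigma x + 1.
  by rewrite ltr_wpDl// /hnorm; apply/bigmax_geP; left.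
have xr : Box sigma (hnorm sigma x + 1) x by rewrite /Box /= ltrDl.
have H := rescale_taylor (Phi_Ck k) (@Phi0 k) r0 e20.
near (0 : R)^'+ => eps.
have L1 : `|L x 0 k - rescale sigma Phi eps x 0 k| < e / 2.
  by have := near (cL _ e20) eps; apply.
have L2 : `|mfun (taylor_part sigma (sigma k) (fun y => Phi y 0 k)) x
    - eps^-1 ^+ sigma k * Phi (dil sigma eps x) 0 k| < e / 2.
  by have := near H eps; apply.
rewrite rescale_coordE in L1.
rewrite (splitr e) ltW//; apply: le_lt_trans (ler_distD _ _ _) _.
by apply: ltrD L1 _; rewrite distrC; exact: L2.
Unshelve. all: by end_near. Qed.

(** On a small [Box sigma s] the limit is bounded, hence so are the rescaled maps of scale [t < d].
    A point [y] of [Box sigma eps] is the dilation by [t = eps / s] of a point there, which bounds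
    [Phi y]. *)
Lemma rescaling_limit_Box V L : rescaling_limit sigma Phi V L ->
  exists C eps0 : R, [/\ 0 < C, 0 < eps0
    & forall eps : R, 0 < eps <= eps0 ->
        Phi @` Box sigma eps `<=` Box sigma (C * eps)].
Proof.
move=> [[oV V0] /uniform_mxP cL dL _].
have /at_right0P[d d0 dP] := cL _ ltr01.
have := differentiable_continuous (dL _ V0).
move=> /cvgrPdist_le/(_ _ ltr01) cL0.
have nV : nbhs (0 : 'rV[R]_N) V by exact: open_nbhs_nbhs.
have [s' s'0 sP] := (at_right0P _).1 (near_Box sigma_gt0 (filterI nV cL0)).
pose s := s' / 2.
have s0 : 0 < s by rewrite divr_gt0.
have ss' : 0 < s < s' by rewrite s0 /s; lra.
(* One unit for the variation of [L] near 0, one for its distance to the rescaled map. *)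
pose M := `|L 0| + 2.
have M1 : 1 <= M by rewrite /M; have := normr_ge0 (L 0); lra.
have M0 : 0 < M by exact: lt_le_trans M1.
(* With [t = eps / s] the target radius is [t * M], and the bound on [eps] forces [t < d]. *)
exists (M / s), (s * (d / 2)); split; rewrite ?divr_gt0 ?mulr_gt0 ?divr_gt0//.
move=> eps /andP[e0 ed] _ [y ye <-].
pose t := eps / s.
have t0 : 0 < t by rewrite divr_gt0.
have td : 0 < t < d.
  rewrite t0 /t ltr_pdivrMr// mulrC; apply: le_lt_trans ed _.
  by rewrite ltr_pM2l//; lra.
pose x := dil sigma t^-1 y.
have yE : y = dil sigma t x.
  have t'0 : t^-1 != 0 by rewrite invr_eq0 gt_eqF.
  by rewrite -[LHS](dilK sigma t'0) invrK.
have xs : Box sigma s x.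
  have -> : s = t^-1 * eps by rewrite /t invf_div divfK// gt_eqF.
  by apply: dil_Box; rewrite ?invr_gt0.
have [Vx Lx] := sP _ ss' _ xs.
have eM : M / s * eps = t * M by rewrite /t mulrC mulrA mulrAC.
rewrite eM; apply/(BoxP sigma_gt0 _ (mulr_gt0 t0 M0)) => k.
have := dP _ td _ Vx 0 k; rewrite rescale_coordE -yE => H.
have Lk : `|L x 0 k| <= `|L 0| + 1.
  apply: le_trans (normr_coord_le _ _) _; rewrite -lerBlDl.
  by apply: le_trans (lerB_dist _ _) _; rewrite distrC.
have HM : `|t^-1 ^+ sigma k * Phi y 0 k| < M.
  rewrite -[X in `|X|](subKr (L x 0 k)); apply: le_lt_trans (ler_normB _ _) _.
  by rewrite /M; lra.
(* Since [M >= 1] and [sigma k >= 1], [M] is at most [M ^+ sigma k]. *)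
rewrite exprMn; apply: lt_le_trans (_ : t ^+ sigma k * M <= _); last first.
  by rewrite ler_pM2l ?exprn_gt0// -[leLHS]expr1; exact: ler_weXn2l.
rewrite mulrC -ltr_pdivrMr ?exprn_gt0//; apply: le_lt_trans HM.
rewrite normrM exprVn mulrC [`|_^-1|]gtr0_norm// invr_gt0 exprn_gt0//.
Qed.

End Equivalences.

(* Phi is a total function, but only its values on U matter: in each condition
   the neighborhood V and the bound on eps may be shrunk so that Phi is only
   evaluated on U. *)
Theorem lemma4 (R : realType) (N : nat) (sigma : 'I_N -> nat)
    (sigma_gt0 : forall k, (0 < sigma k)%N)
    (U : set 'rV[R]_N) (U_nbhs : open_nbhs (0 : 'rV[R]_N) U)
    (Phi : 'rV[R]_N -> 'rV[R]_N)
    (Phi_Ck : forall k, Ck (sigma k) U (fun x => Phi x 0 k)) :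
  [<-> exists C eps0 : R,
         [/\ 0 < C, 0 < eps0
           & forall eps : R, 0 < eps <= eps0 ->
               Phi @` Box sigma eps `<=` Box sigma (C * eps)];
       forall k : 'I_N, exists C : R,
         \forall eps \near 0^'+, forall x, Box sigma eps x ->
           `|Phi x 0 k| <= C * eps ^+ sigma k;
       forall (k : 'I_N) (alpha : multinom N),
         (weight sigma alpha < sigma k)%N ->
         Dmulti alpha (fun x => Phi x 0 k) 0 = 0;
       exists V L, rescaling_limit sigma Phi V L]
  /\
  (forall V L, rescaling_limit sigma Phi V L ->
     forall k : 'I_N, exists p : mpoly N R,
       forall x, V x -> L x 0 k = meval (fun i => x 0 i) p).
Proof.
have [oU U0] := U_nbhs.
have der0 : (forall k : 'I_N, exists C : R, \forall eps \near 0^'+, forall x,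
      Box sigma eps x -> `|Phi x 0 k| <= C * eps ^+ sigma k) ->
    forall (k : 'I_N) alpha, (weight sigma alpha < sigma k)%N ->
      Dmulti alpha (fun x => Phi x 0 k) 0 = 0.
  by move=> PhiO k; have [C] := PhiO k; exact: bigO_Dmulti0 (Phi_Ck k).
have bigO : (exists C eps0 : R, [/\ 0 < C, 0 < eps0
      & forall eps : R, 0 < eps <= eps0 ->
          Phi @` Box sigma eps `<=` Box sigma (C * eps)]) ->
    forall k : 'I_N, exists C : R, \forall eps \near 0^'+, forall x,
      Box sigma eps x -> `|Phi x 0 k| <= C * eps ^+ sigma k.
  move=> [C [eps0 [C0 eps00 PhiB]]] k; exists (C ^+ sigma k).
  near=> eps => x xe.
  have e0 : 0 < eps by [].
  have ee : 0 < eps <= eps0.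
    by rewrite e0 /=; near: eps; exact: nbhs_right_le.
  have /BoxP H : Box sigma (C * eps) (Phi x) by apply: (PhiB _ ee); exists x.
  by rewrite -exprMn ltW// H// mulr_gt0.
split.
  tfae.
  - exact: bigO.
  - exact: der0.
  - by move=> Phi0; exists (ball 0 1), (taylor_map sigma Phi);
      exact: (rescaling_limit_taylor sigma_gt0 oU U0 Phi_Ck Phi0).
  - by move=> [V [L VL]]; exact: rescaling_limit_Box VL.
move=> V L VL k.
exists (taylor_part sigma (sigma k) (fun y => Phi y 0 k)) => x Vx.
(* Condition 4 yields 1, 2 and 3 in turn, so that [L] can be identified with the Taylor part on
   [V]. *)
have Phi0 := der0 (bigO (rescaling_limit_Box sigma_gt0 VL)).
by rewrite (rescaling_limit_eq_taylor sigma_gt0 oU U0 Phi_Ck Phi0 VL Vx) mxE.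
Unshelve. all: by end_near. Qed.
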